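(* Let $\kappa\ge1$, $M\ge3$ and let $\{f_1,\dots,f_M\}$ be a finite set of prediction rules. Assume that $\pi$ satisfies the margin assumption MA($\kappa$). The aggregate with exponential weights $\tilde f_n=\sum_{j=1}^M w_j^{(n)}f_j$, where $$w_j^{(n)}=\frac{\exp\left(\sum_{i=1}^nY_if_j(X_i)\right)}{\sum_{k=1}^M\exp\left(\sum_{i=1}^nY_if_k(X_i)\right)},\quad j=1,\dots,M,$$ satisfies for any number $a>0$ and any integers $n,M$ the following inequality, with $C>0$ a constant depending only on $a$: $$\mathbb E\left[R(\tilde f_n)-R^*\right]\le2(1+a)\min_{j=1,\dots,M}(R(f_j)-R^* )+C\left(\frac{\log M}{n}\right)^{\frac{\kappa}{2\kappa-1}}.$$
   Context: $(\mathcal X,\mathcal A)$ is a measurable space, $(X,Y)$ is a random variable with values in $\mathcal X\times\{-1,1\}$ and distribution $\pi$, and $D_n=(X_i,Y_i)_{i=1,\dots,n}$ are $n$ i.i.d. observations of $(X,Y)$. A prediction rule is a measurable function $f:\mathcal X\to\{-1,1\}$; its misclassification error is $R(f)=\mathbb P(Y\ne f(X))$. For a measurable real valued $f$, $R(f)$ denotes the misclassification error of $\mathrm{sign}(f)$. For the data-dependent function $\tilde f_n$, $R(\tilde f_n)$ is the misclassification error conditionally on $D_n$, and the outer expectation is over $D_n$. Let $\eta(x)=\mathbb P(Y=1\mid X=x)$; the Bayes rule is $f^*(x)=\mathrm{sign}(2\eta(x)-1)$, and $R^*=R(f^* )=\min_fR(f)$. Margin assumption MA($\kappa$), $1\le\kappa<+\infty$: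 there exists $c_0>0$ such that $\mathbb E|f(X)-f^*(X)|\le c_0(R(f)-R^* )^{1/\kappa}$ for all measurable $f:\mathcal X\to\{-1,1\}$.
   Formalization: The constant C is allowed to depend on the constant c_0 of the margin assumption MA(κ) as well as on a (not on κ, π, n, M or the rules), since a bound with C depending only on a fails, e.g. for κ=1 with c_0 of order √n. *)

(* Defs.v *)
From HB Require Import structures.
From mathcomp Require Import all_boot all_order all_algebra.
From mathcomp Require Import all_classical all_reals all_analysis.

Set Implicit Arguments.
Unset Strict Implicit.
Unset Printing Implicit Defensive.

Import Order.TTheory GRing.Theory Num.Theory.
Import numFieldNormedType.Exports.

Local Open Scope classical_set_scope.
Local Open Scope ring_scope.

(* The labels -1 and 1 are real numbers. An observation is a point z : T * R
   with z.1 the design point X and z.2 the label Y; the generic pair (X, Y) is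
   the identity on (T * R, pi). *)
Definition binary_labels (R : realType) (d : measure_display)
    (T : measurableType d) (pi : probability (T * R)%type R) : Prop :=
  pi ([set: T] `*` [set y : R | y = -1 \/ y = 1]) = 1%E.

Definition prediction_rule (R : realType) (d : measure_display)
    (T : measurableType d) (f : T -> R) : Prop :=
  measurable_fun [set: T] f /\ forall x, f x = -1 \/ f x = 1.

(* Unlike Num.sg, sign 0 = 1, so that the sign of a measurable function is
   always a prediction rule. *)
Definition sign (R : realType) (t : R) : R := if 0 <= t then 1 else -1.

(* If f is a prediction rule then sign \o f = f. *)
Definition risk (R : realType) (d : measure_display) (T : measurableType d)
    (pi : probability (T * R)%type R) (f : T -> R) : R :=
  fine (pi [set z : T * R | z.2 != sign (f z.1)]).

(* eta is a version of the conditional probability P(Y = 1 | X = x). *)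
Definition regression_function (R : realType) (d : measure_display)
    (T : measurableType d) (pi : probability (T * R)%type R)
    (eta : T -> R) : Prop :=
  measurable_fun [set: T] eta /\
  forall A : set T, measurable A ->
    (\int[pi]_(z in A `*` [set: R]) (eta z.1)%:E = pi (A `*` [set 1%R]))%E.

Definition bayes_rule (R : realType) (d : measure_display)
    (T : measurableType d) (eta : T -> R) : T -> R :=
  fun x => sign (2 * eta x - 1).

Definition excess_risk (R : realType) (d : measure_display)
    (T : measurableType d) (pi : probability (T * R)%type R)
    (eta : T -> R) (f : T -> R) : R :=
  risk pi f - risk pi (bayes_rule eta).

(* The constant c0 of the margin assumption is a parameter rather than
   existentially quantified, since constants in risk bounds depend on it. *)
Definition margin_assumption (R : realType) (d : measure_display)
    (T : measurableType d) (pi : probability (T * R)%type R)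
    (eta : T -> R) (kappa c0 : R) : Prop :=
  forall f : T -> R, prediction_rule f ->
    ('E_pi[fun z : T * R => `|f z.1 - bayes_rule eta z.1|%R]
      <= (c0 * (excess_risk pi eta f) `^ (1 / kappa))%:E)%E.

(* Same law pi, and mutual independence as the product rule over subfamilies. *)
Definition iid_sample (R : realType) (dO d : measure_display)
    (Omega : measurableType dO) (P : probability Omega R)
    (S : measurableType d) (pi : probability S R)
    (n : nat) (Z : 'I_n -> {RV P >-> S}) : Prop :=
  (forall i (A : set S), measurable A -> distribution P (Z i) A = pi A) /\
  (forall (J : {set 'I_n}) (A : 'I_n -> set S),
    (forall i, measurable (A i)) ->
    P (\bigcap_(i in [set i | i \in J]) (Z i @^-1` A i)) =
      (\prod_(i in J) P (Z i @^-1` A i))%E).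

Definition aew_weight (R : realType) (T : Type) (n M : nat)
    (f : 'I_M -> T -> R) (D : 'I_n -> T * R) (j : 'I_M) : R :=
  expR (\sum_(i < n) (D i).2 * f j (D i).1) /
  \sum_(k < M) expR (\sum_(i < n) (D i).2 * f k (D i).1).

Definition aew (R : realType) (T : Type) (n M : nat)
    (f : 'I_M -> T -> R) (D : 'I_n -> T * R) : T -> R :=
  fun x => \sum_(j < M) aew_weight f D j * f j x.

(* Main.v *)
Require Import Defs.
From HB Require Import structures.
From mathcomp Require Import all_boot all_order all_algebra.
From mathcomp Require Import all_classical all_reals all_analysis.
From mathcomp Require Import measurable_realfun.
From mathcomp Require Import ring lra.

(** Why the inequality holds. For a prediction rule the gain of [f] at
    [(x, y)] is [y * f x], and twice the excess risk of [f] is the mean [m] of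
    the gain deficit [D = y * f^* x - y * f x]. The gain is linear in [f], so
    for weights [w_j] depending on the sample the convex combination has mean
    deficit [\sum_j w_j * m_j], and this dominates its excess risk (Zhang's
    comparison of the hinge loss with the 0-1 loss, [excess_risk_le_hinge]).
    The passage from excess risk to deficit for a single rule is the factor 2
    of the theorem ([excess_risk_rule]). It remains to bound [E (\sum_j w_j * m_j)] by
    [(1 + a) * m_k] plus a remainder, for every [k]; this is
    [gibbs_oracle_inequality].

    Exponential weights almost minimize the empirical deficit [S_j] among all
    rules, up to [ln M] ([gibbs_near_optimal]). Writing
    [m_j = (1 + a) * S_j / n + U_j], the first part averages to at most
    [(1 + a) * (m_k + ln M / n)]; the second, by Jensen, to at most
    [ln (\sum_j E (exp (lam * U_j))) / lam]. Independence and the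
    bound [exp x <= 1 + x + 2 x^2] give
    [E (exp (lam * U_j)) <= exp (lam * (- a * m_j + c' * E (D_j^2)))] with [c']
    proportional to [lam / n]. Under the margin assumption [E (D_j^2)] is at
    most a constant times [m_j `^ (1 / kappa)], and Young's inequality
    ([margin_young]) shows that the linear term [- a * m_j] absorbs it up to
    [r = (ln M / n) `^ (kappa / (2 * kappa - 1))], provided that [lam] is a
    small multiple of [ln M / r]. All constants are explicit in [a] and [c0].
    If [ln M > n] the remainder exceeds 1 and there is nothing to prove.

    The probability theory takes place on a finite space. All that matters of an
    observation [(x, y)] is the vector of signs of [f_1 x, .., f_M x, f^* x]
    together with the label, so the sample is replaced by a random element of
    a finite product, whose law is the product of the laws of its coordinates
    ([sample_law]), and expectations become finite sums ([expectation_law]).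
    Observations whose label is neither 1 nor -1 carry the label [None], to
    which that law gives no mass. *)

Set Implicit Arguments.
Unset Strict Implicit.
Unset Printing Implicit Defensive.

Import Order.TTheory GRing.Theory Num.Theory.
Import numFieldNormedType.Exports.

Local Open Scope classical_set_scope.
Local Open Scope ring_scope.

(** * Two real inequalities *)

Section RealInequalities.
Context {R : realType}.
Implicit Types x s t kappa : R.

(** [expR x <= (1 - x)^-1 = 1 + x + x ^+ 2 / (1 - x)], and [1 - x >= 1 / 2]. *)
Lemma expR_le_quadratic x : x <= 1 / 2 -> expR x <= 1 + x + 2 * x ^+ 2.
Proof.
move=> hx.
have h1 : 0 < 1 - x by lra.
have h2 : expR x * (1 - x) <= 1.
  rewrite -[leRHS](expRxMexpNx_1 x) ler_wpM2l ?expR_ge0//.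
  exact: expR_ge1Dx.
rewrite -(ler_pM2r h1) (le_trans h2)//.
suff -> : (1 + x + 2 * x ^+ 2) * (1 - x) = 1 + x ^+ 2 * (1 - 2 * x).
  by rewrite lerDl mulr_ge0 ?sqr_ge0//; lra.
by ring.
Qed.

(** Absorption of the margin term. In terms of
    [r = s `^ (kappa / (2 * kappa - 1))], the first factor is
    [r `^ (1 - 1 / kappa)], so the product is a weighted geometric mean of [r]
    and [t], at most the larger of the two. *)
Lemma margin_young kappa s t : 1 <= kappa -> 0 < s -> 0 <= t ->
  s `^ ((kappa - 1) / (2 * kappa - 1)) * t `^ (1 / kappa)
    <= s `^ (kappa / (2 * kappa - 1)) + t.
Proof.
move=> hk hs ht; set r := s `^ (kappa / _).
have k0 : kappa != 0 by apply: lt0r_neq0; lra.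
have k1 : 2 * kappa - 1 != 0 by apply: lt0r_neq0; lra.
have r0 : 0 < r by rewrite powR_gt0.
have -> : s `^ ((kappa - 1) / (2 * kappa - 1)) = r `^ (1 - 1 / kappa).
  by rewrite -powRrM; congr (_ `^ _); field; rewrite k1 k0.
have e1 : 0 <= 1 / kappa by rewrite divr_ge0//; lra.
have e2 : 0 <= 1 - 1 / kappa by rewrite subr_ge0 ler_pdivrMr; lra.
have [htr|/ltW hrt] := leP t r.
  apply: (@le_trans _ _ r); last by lra.
  apply: (@le_trans _ _ (r `^ (1 - 1 / kappa) * r `^ (1 / kappa))).
    by rewrite ler_wpM2l ?powR_ge0// ge0_ler_powR// nnegrE// ltW.
  by rewrite -powRD ?subrK ?powRr1 ?(ltW r0)// oner_eq0.
apply: (@le_trans _ _ t); last by lra.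
apply: (@le_trans _ _ (t `^ (1 - 1 / kappa) * t `^ (1 / kappa))).
  by rewrite ler_wpM2r ?powR_ge0// ge0_ler_powR// nnegrE// ltW.
by rewrite -powRD ?subrK ?powRr1// oner_eq0.
Qed.

End RealInequalities.

(** * Exponential weights *)

Section GibbsWeights.
Context {R : realType} {J : finType}.
Implicit Types w x : J -> R.

Definition gibbs x (j : J) : R := expR (x j) / \sum_k expR (x k).

Lemma gibbs_partition_gt0 x (j : J) : 0 < \sum_k expR (x k).
Proof.
by rewrite (bigD1 j)//= ltr_wpDr ?expR_gt0// sumr_ge0.
Qed.

Lemma gibbs_gt0 x j : 0 < gibbs x j.
Proof. by rewrite divr_gt0 ?expR_gt0 ?(gibbs_partition_gt0 x j). Qed.

Lemma gibbs_sum1 x (j : J) : \sum_k gibbs x k = 1.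
Proof.
by rewrite -mulr_suml divff// lt0r_neq0// (gibbs_partition_gt0 x j).
Qed.

(** Since [x k = ln (gibbs x k) + ln W] with [W] the normalization, the average
    of [x] is [ln W], which is at least [x j], minus the entropy of the
    weights, which is at most [ln #|J|]. *)
Lemma gibbs_near_optimal x (j : J) :
  x j - ln #|J|%:R <= \sum_k gibbs x k * x k.
Proof.
set W := \sum_k expR (x k).
have W0 : 0 < W := gibbs_partition_gt0 x j.
have J0 : 0 < #|J|%:R :> R by rewrite ltr0n; apply/card_gt0P; exists j.
have hW : x j <= ln W.
  rewrite -[leLHS]expRK ler_ln ?posrE ?expR_gt0//.
  by rewrite /W (bigD1 j)//= lerDl sumr_ge0// => k _; exact: expR_ge0.
(* the entropy bound, by 1 + t <= exp t in each term; the sum of the right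
   hand sides is 0 *)
have key k : gibbs x k * (ln W - ln #|J|%:R - x k) <= #|J|%:R^-1 - gibbs x k.
  have -> : #|J|%:R^-1 - gibbs x k
      = gibbs x k * (expR (ln W - ln #|J|%:R - x k) - 1).
    rewrite !expRB !lnK ?posrE// /gibbs -/W; field.
    by rewrite !lt0r_neq0 ?expR_gt0.
  rewrite ler_wpM2l ?(ltW (gibbs_gt0 _ _))// lerBrDl; exact: expR_ge1Dx.
have : \sum_k gibbs x k * (ln W - ln #|J|%:R - x k)
    <= \sum_k (#|J|%:R^-1 - gibbs x k) by apply: ler_sum => k _; exact: key.
rewrite [X in _ <= X -> _]sumrB sumr_const -(mulr_natr _^-1) mulVf ?lt0r_neq0//.
rewrite (gibbs_sum1 x j) subrr.
under eq_bigr do rewrite mulrBr.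
rewrite sumrB -mulr_suml (gibbs_sum1 x j) mul1r; lra.
Qed.

(** The average is at most [lam^-1 * ln Q] with [Q] the sum of exponentials;
    here [ln] is replaced by its tangent at [K], so that the bound is affine in
    [Q] and expectations can be taken in it. With [K] a bound for the mean of
    [Q], the outcome is that of Jensen's inequality. *)
Lemma average_le_log_sum_exp w (u : J -> R) (lam K : R) :
  (forall j, 0 <= w j) -> \sum_j w j = 1 -> 0 < lam -> 0 < K ->
  \sum_j w j * u j
    <= lam^-1 * (ln K - 1 + K^-1 * \sum_j expR (lam * u j)).
Proof.
move=> w0 w1 l0 K0; rewrite -[leRHS]mul1r -w1 mulr_suml.
apply: ler_sum => j _; rewrite ler_wpM2l//.
rewrite -[leLHS](mulKf (lt0r_neq0 l0)) ler_wpM2l ?invr_ge0 ?(ltW l0)//.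
have h1 : expR (lam * u j) <= \sum_k expR (lam * u k).
  by rewrite (bigD1 j)//= lerDl sumr_ge0// => k _; exact: expR_ge0.
have h2 : K^-1 * expR (lam * u j) <= K^-1 * \sum_k expR (lam * u k).
  by rewrite ler_wpM2l// invr_ge0 ltW.
have := expR_ge1Dx (lam * u j - ln K).
rewrite expRB lnK ?posrE// [X in _ <= X -> _]mulrC; lra.
Qed.

End GibbsWeights.

(** * Means and product laws on finite spaces *)

Section FiniteMean.
Context {R : realType}.

Definition mean (V : finType) (q : V -> R) (phi : V -> R) : R :=
  \sum_v q v * phi v.

Definition is_pmf (V : finType) (q : V -> R) : Prop :=
  (forall v, 0 <= q v) /\ \sum_v q v = 1.

Definition iid_pmf (V : finType) (n : nat) (q : V -> R)
  (v : {ffun 'I_n -> V}) : R := \prod_i q (v i).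

Section OneSpace.
Context (V : finType) (q : V -> R) (hq : is_pmf q).
Implicit Types phi psi : V -> R.

Lemma meanD phi psi :
  mean q (fun v => phi v + psi v) = mean q phi + mean q psi.
Proof. by rewrite /mean -big_split; apply: eq_bigr => v _; rewrite mulrDr. Qed.

Lemma meanZ c phi : mean q (fun v => c * phi v) = c * mean q phi.
Proof. by rewrite /mean mulr_sumr; apply: eq_bigr => v _; rewrite mulrCA. Qed.

Lemma mean_sum (K : finType) (phi : K -> V -> R) :
  mean q (fun v => \sum_k phi k v) = \sum_k mean q (phi k).
Proof.
by rewrite /mean exchange_big; apply: eq_bigr => v _; rewrite mulr_sumr.
Qed.

Lemma mean_cst c : mean q (fun=> c) = c.
Proof. by rewrite /mean -mulr_suml hq.2 mul1r. Qed.

Lemma mean_le phi psi : (forall v, phi v <= psi v) -> mean q phi <= mean q psi.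
Proof. by move=> h; apply: ler_sum => v _; rewrite ler_wpM2l// hq.1. Qed.

Lemma mean_ge0 phi : (forall v, 0 <= phi v) -> 0 <= mean q phi.
Proof. by move=> h; apply: sumr_ge0 => v _; rewrite mulr_ge0// hq.1. Qed.

End OneSpace.

Lemma eq_mean (V : finType) (q phi psi : V -> R) :
  phi =1 psi -> mean q phi = mean q psi.
Proof. by move=> h; apply: eq_bigr => v _; rewrite h. Qed.

(** Independence: expanding the product of the sums. *)
Lemma mean_iid_prod (V : finType) (n : nat) (q : V -> R)
    (phi : 'I_n -> V -> R) :
  mean (iid_pmf q) (fun v : {ffun 'I_n -> V} => \prod_i phi i (v i))
    = \prod_i mean q (phi i).
Proof.
by rewrite /mean bigA_distr_bigA; apply: eq_bigr => v _; rewrite -big_split.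
Qed.

Lemma iid_pmfP (V : finType) (n : nat) (q : V -> R) :
  is_pmf q -> is_pmf (@iid_pmf V n q).
Proof.
move=> hq; split=> [v|]; first by apply: prodr_ge0 => i _; exact: hq.1.
have := @mean_iid_prod V n q (fun _ _ => 1).
rewrite [RHS]big1 => [<-|i _]; last exact: mean_cst.
by apply: eq_bigr => v _; rewrite big1 ?mulr1.
Qed.

Lemma mean_iid_coord (V : finType) (n : nat) (q : V -> R) (phi : V -> R) i :
  is_pmf q ->
  mean (iid_pmf q) (fun v : {ffun 'I_n -> V} => phi (v i)) = mean q phi.
Proof.
move=> hq.
have := @mean_iid_prod V n q (fun k => if k == i then phi else fun=> 1).
rewrite (bigD1 i)//= eqxx big1 ?mulr1 => [<-|k /negbTE->]; last exact: mean_cst.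
apply: eq_mean => v; rewrite (bigD1 i)//= eqxx big1 ?mulr1// => k /negbTE->//.
Qed.

Lemma mean_iid_sum (V : finType) (n : nat) (q : V -> R) (phi : V -> R) :
  is_pmf q ->
  mean (iid_pmf q) (fun v : {ffun 'I_n -> V} => \sum_i phi (v i))
    = n%:R * mean q phi.
Proof.
move=> hq; rewrite mean_sum (eq_bigr (fun=> mean q phi)) => [|i _].
  by rewrite sumr_const card_ord mulr_natl.
exact: mean_iid_coord.
Qed.

(** A Bernstein type bound: the exponential moment of a sum of independent
    copies of a bounded [D] is governed by the first two moments of [D]. *)
Lemma mean_expR_sum_le (V : finType) (n : nat) (q D : V -> R) (t : R) :
  is_pmf q -> (forall v, - t * D v <= 1 / 2) ->
  mean (iid_pmf q) (fun v : {ffun 'I_n -> V} => expR (- t * \sum_i D (v i)))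
    <= expR (n%:R * (- t * mean q D
                     + 2 * t ^+ 2 * mean q (fun v => D v ^+ 2))).
Proof.
move=> hq hD.
rewrite (@eq_mean _ _ _ (fun v : {ffun 'I_n -> V} =>
    \prod_i expR (- t * D (v i)))); last first.
  by move=> v; rewrite -expR_sum mulr_sumr.
rewrite (@mean_iid_prod V n q (fun=> fun v => expR (- t * D v))).
rewrite prodr_const card_ord expRM_natl lerXn2r ?nnegrE ?expR_ge0//.
  by apply: mean_ge0 => // v; exact: expR_ge0.
apply: le_trans (expR_ge1Dx _).
rewrite -[X in X + _](mean_cst hq) -!meanZ -!meanD; apply: mean_le => // v.
by apply: le_trans (expR_le_quadratic (hD v)) _; lra.
Qed.

End FiniteMean.

(** * The oracle inequality for exponential weights *)

(** The probabilistic core, for abstract gains: [g j] is the gain of the [j]-th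
    competitor, [g0] that of the ideal one, and [m j] the mean deficit. The
    variance hypothesis is the margin assumption in terms of [m]. *)
Lemma gibbs_oracle_inequality (R : realType) (V : finType) (q : V -> R)
    (n M : nat) (a b kappa : R) (g : 'I_M -> V -> R) (g0 : V -> R)
    (m := fun j => mean q (fun v => g0 v - g j v))
    (w := fun v : {ffun 'I_n -> V} => gibbs (fun j => \sum_i g j (v i)))
    (s := ln M%:R / n%:R) :
  0 < a -> 0 <= b -> 1 <= kappa -> is_pmf q -> (0 < n)%N ->
  (forall j v, `|g0 v - g j v| <= 2) ->
  (forall j, 0 <= m j) ->
  (forall j, mean q (fun v => (g0 v - g j v) ^+ 2) <= b * m j `^ (1 / kappa)) ->
  0 < s -> s <= 1 ->
  forall j, mean (iid_pmf q) (fun v => \sum_k w v k * m k)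
    <= (1 + a) * m j
       + (1 + 2 * a + 4 * (1 + a) ^+ 2 * (1 + b) / a)
         * s `^ (kappa / (2 * kappa - 1)).
Proof.
move=> a0 b0 hk hq n0 hg hm hvar s0 s1 j.
have nR : 0 < n%:R :> R by rewrite ltr0n.
have M0 : 0 < M%:R :> R by rewrite ltr0n; exact: leq_ltn_trans (ltn_ord j).
(* small enough that t <= 1 / 4 below, which keeps the exponents in the range of
   the quadratic bound, and that the variance term is at most a * (r + m k) *)
pose c := a / (4 * (1 + a) ^+ 2 * (1 + b)).
have a1 : 0 < 1 + a by lra.
have b1 : 0 < 1 + b by lra.
have c0 : 0 < c by rewrite divr_gt0// !mulr_gt0// exprn_gt0.
set r := s `^ (kappa / (2 * kappa - 1)).
pose rho := s `^ ((kappa - 1) / (2 * kappa - 1)).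
have rho0 : 0 < rho by rewrite powR_gt0.
have k1 : 0 < 2 * kappa - 1 by lra.
have rho1 : rho <= 1.
  rewrite -(powRr0 s); apply: ger_powR; first by rewrite s0.
  by rewrite divr_ge0//; lra.
have r0 : 0 < r by rewrite powR_gt0.
have srho : s = r * rho.
  rewrite /r /rho -powRD; last by rewrite (lt0r_neq0 s0) implybT.
  by rewrite -mulrDl (_ : _ / _ = 1) ?powRr1 ?(ltW s0)//; field; exact: lt0r_neq0.
have sr : s <= r by rewrite srho ger_pMr.
(* lam is c * ln M / r, which makes ln M / lam a multiple of r *)
pose lam := c * n%:R * rho.
have lam0 : 0 < lam by rewrite mulr_gt0// mulr_gt0.
pose t := lam * (1 + a) / n%:R.
have tE : t = c * (1 + a) * rho by rewrite /t /lam; field; exact: lt0r_neq0.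
have caE : c * (1 + a) ^+ 2 * (4 * (1 + b)) = a.
  by rewrite /c; field; rewrite !lt0r_neq0.
have t0 : 0 < t by rewrite tE mulr_gt0// mulr_gt0.
have t4 : t <= 1 / 4.
  have h1 : t <= c * (1 + a).
    rewrite tE ger_pMr// mulr_gt0//; lra.
  suff : c * (1 + a) <= 1 / 4 by lra.
  have h2 : c * (1 + a) * (1 + a) * 4 <= a.
    have : 0 <= c * (1 + a) ^+ 2 * b by rewrite mulr_ge0// mulr_ge0 ?sqr_ge0 ?ltW.
    by move: caE; lra.
  nra.
pose K := M%:R * expR (lam * (a * r)).
have K0 : 0 < K by rewrite mulr_gt0 ?expR_gt0.
pose S k (v : {ffun 'I_n -> V}) := \sum_i (g0 (v i) - g k (v i)).
(* the part of m k that is not explained by (1 + a) times its empirical value *)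
pose U v k := m k - (1 + a) / n%:R * S k v.
have mgf k : mean (iid_pmf q) (fun v => expR (lam * U v k))
    <= expR (lam * (a * r)).
  rewrite (@eq_mean _ _ _ _ (fun v : {ffun 'I_n -> V} =>
      expR (lam * m k) * expR (- t * S k v)));
    last first.
    by move=> v; rewrite -expRD /U /t; congr expR; ring.
  rewrite meanZ.
  have hD v : - t * (g0 v - g k v) <= 1 / 2.
    have := hg k v; rewrite ler_norml => /andP[h1 h2]; nra.
  apply: le_trans (ler_wpM2l (expR_ge0 _) (mean_expR_sum_le n hq hD)) _.
  rewrite -expRD ler_expR -/(m k).
  have hv := hvar k; set v2 := mean q _ in hv *.
  have -> : lam * m k + n%:R * (- t * m k + 2 * t ^+ 2 * v2)
      = lam * (- (a * m k) + 2 * c * (1 + a) ^+ 2 * rho * v2).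
    by rewrite expr2 {2}tE /t; field; exact: lt0r_neq0.
  rewrite ler_pM2l//.
  have hy := ler_wpM2l (ltW a0) (margin_young hk s0 (hm k)).
  suff : 2 * c * (1 + a) ^+ 2 * rho * v2 <= a * (rho * m k `^ (1 / kappa)).
    by move: hy; rewrite mulrDr -/rho -/r; lra.
  set p := m k `^ (1 / kappa) in hv *.
  have p0 : 0 <= p by exact: powR_ge0.
  set X := c * (1 + a) ^+ 2 * rho.
  have X0 : 0 <= X.
    rewrite mulr_ge0 ?(ltW rho0)// mulr_ge0 ?(ltW c0)//; exact: sqr_ge0.
  have -> : 2 * c * (1 + a) ^+ 2 * rho * v2 = 2 * (X * v2) by rewrite /X; ring.
  have -> : a * (rho * p) = 4 * (X * p) + 4 * (X * (b * p)).
    by rewrite -[X in X * _]caE /X; ring.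
  have hXv := ler_wpM2l X0 hv.
  have hXp : 0 <= X * p by rewrite mulr_ge0.
  have hXb : 0 <= X * (b * p) by rewrite mulr_ge0// mulr_ge0.
  by lra.
(* for each sample, only expressions with computable mean remain on the right *)
have pointwise v : \sum_k w v k * m k
    <= (1 + a) / n%:R * (S j v + ln M%:R)
       + lam^-1 * (ln K - 1 + K^-1 * \sum_k expR (lam * U v k)).
  have w0 k : 0 <= w v k by exact/ltW/gibbs_gt0.
  have w1 : \sum_k w v k = 1 by exact: gibbs_sum1 j.
  have h1 := average_le_log_sum_exp (U v) w0 w1 lam0 K0.
  have h2 := gibbs_near_optimal (fun j => \sum_i g j (v i)) j.
  rewrite card_ord in h2.
  have h3 : \sum_k w v k * U v k
      = \sum_k w v k * m k - (1 + a) / n%:R * \sum_k w v k * S k v.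
    rewrite mulr_sumr -sumrB; apply: eq_bigr => k _; rewrite /U; ring.
  have h4 : \sum_k w v k * S k v <= S j v + ln M%:R.
    have -> : \sum_k w v k * S k v
        = \sum_i g0 (v i) - \sum_k w v k * \sum_i g k (v i).
      rewrite -[X in X - _]mul1r -w1 mulr_suml -sumrB.
      by apply: eq_bigr => k _; rewrite /S sumrB mulrBr.
    rewrite /S sumrB; rewrite /w in h2 *; lra.
  have h5 : (1 + a) / n%:R * \sum_k w v k * S k v
      <= (1 + a) / n%:R * (S j v + ln M%:R).
    by rewrite ler_wpM2l// divr_ge0//; lra.
  lra.
have hN := iid_pmfP n hq.
apply: le_trans (mean_le hN pointwise) _.
rewrite meanD meanZ meanD (mean_cst hN) meanZ meanD (mean_cst hN) meanZ mean_sum.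
have -> : mean (iid_pmf q) (fun v => S j v) = n%:R * m j.
  exact: (mean_iid_sum n (fun v => g0 v - g j v) hq).
have hQ : K^-1 * \sum_k mean (iid_pmf q) (fun v => expR (lam * U v k)) <= 1.
  rewrite mulrC ler_pdivrMr// mul1r (le_trans (ler_sum _ (fun k _ => mgf k)))//.
  by rewrite sumr_const card_ord -mulr_natl.
have lnK : ln K = ln M%:R + lam * (a * r).
  by rewrite /K lnM ?posrE ?expR_gt0// expRK.
have h6 : lam^-1 * (ln K - 1 + K^-1 * \sum_k mean (iid_pmf q) (fun v => expR (lam * U v k)))
   <= lam^-1 * ln K.
  rewrite ler_wpM2l ?invr_ge0 ?(ltW lam0)//; lra.
have h7 : lam^-1 * ln K = c^-1 * r + a * r.
  have lnE : ln M%:R = n%:R * (r * rho).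
    by rewrite -srho /s; field; exact: lt0r_neq0.
  by rewrite lnK lnE /lam; field; rewrite !lt0r_neq0.
have h8 : (1 + a) / n%:R * (n%:R * m j + ln M%:R) = (1 + a) * m j + (1 + a) * s.
  by rewrite /s; field; exact: lt0r_neq0.
have h9 : c^-1 = 4 * (1 + a) ^+ 2 * (1 + b) / a by rewrite /c invf_div.
rewrite h8 -h9.
have : (1 + a) * s <= (1 + a) * r by rewrite ler_wpM2l//; lra.
rewrite h7 in h6; lra.
Qed.

(** * Finitely valued functions of random variables *)

(** Monotonicity without measurability: the integral of a nonnegative function
    is the supremum of the integrals of the simple functions below it. It is
    applied to the risk of the aggregate as a function of the sample. *)
Lemma expectation_mono (R : realType) (d : measure_display)
    (Omega : measurableType d) (P : probability Omega R) (F G : Omega -> R) :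
  (forall w, 0 <= F w) -> (forall w, F w <= G w) -> ('E_P[F] <= 'E_P[G])%E.
Proof.
move=> F0 FG; rewrite unlock !ge0_integralTE//.
- apply: le_ereal_sup => _ [h /= hF <-]; exists h => // w.
  by apply: le_trans (hF w) _; rewrite lee_fin.
- by move=> w; rewrite lee_fin (le_trans (F0 w)).
Qed.

Definition measurable_fibers (d : measure_display) (S : measurableType d)
  (V : finType) (p : S -> V) : Prop := forall v, measurable (p @^-1` [set v]).

Definition law (R : realType) (d : measure_display) (S : measurableType d)
  (P : probability S R) (V : finType) (p : S -> V) (v : V) : R :=
  fine (P (p @^-1` [set v])).

Section FinitelyValued.
Context (R : realType) (d : measure_display) (S : measurableType d).
Context (P : probability S R) (V : finType) (p : S -> V).
Context (hp : measurable_fibers p).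

Lemma lawE v : (law P p v)%:E = P (p @^-1` [set v]).
Proof. by rewrite /law fineK// fin_num_measure. Qed.

Lemma expectation_law (phi : V -> R) :
  ('E_P[fun z => phi (p z)] = (mean (law P p) phi)%:E)%E.
Proof.
rewrite unlock.
rewrite (eq_integral (fun z => \sum_v (phi v)%:E * (\1_(p @^-1` [set v]) z)%:E)%E);
  last first.
  move=> z _; rewrite (bigD1 (p z))//= big1 ?adde0 => [|v vz].
    by rewrite indicE mem_set//= mule1.
  by rewrite indicE memNset ?mule0//= => zv; rewrite zv eqxx in vz.
have iI v : P.-integrable setT (fun z => (\1_(p @^-1` [set v]) z)%:E).
  by apply: integrable_indic => //; exact: hp.
rewrite integral_sum//; last by move=> v; exact: integrableZl.
rewrite /mean -sumEFin; apply: eq_bigr => v _.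
rewrite integralZl// integral_indic ?setIT; [|exact: measurableT|exact: hp].
by rewrite EFinM lawE muleC.
Qed.

Lemma law_pmf : is_pmf (law P p).
Proof.
split=> [v|]; first by rewrite /law fine_ge0.
have := expectation_law (fun=> 1).
rewrite (_ : (fun=> 1) = cst 1)// expectation_cst => -[h].
by rewrite [RHS]h /mean; apply: eq_bigr => v _; rewrite mulr1.
Qed.

Lemma law_pred (B : pred V) : 
  fine (P [set z | B (p z)]) = mean (law P p) (fun v => (B v)%:R).
Proof.
have mB : measurable [set z | B (p z)].
  rewrite (_ : [set z | _] = \bigcup_(v in [set` B]) (p @^-1` [set v])).
    by apply: fin_bigcup_measurable => // v _; exact: hp.
  by apply/seteqP; split => [z Bz|z [v /= Bv pz]]; [exists (p z)|rewrite /= pz].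
rewrite -(expectation_indic P mB).
have -> : \1_[set z | B (p z)] = (fun z => (B (p z))%:R) :> (S -> R).
  apply/funext => z; rewrite indicE; congr (_%:R); congr nat_of_bool.
  by apply/idP/idP; rewrite inE.
by rewrite (expectation_law (fun v => (B v)%:R)).
Qed.

End FinitelyValued.

Section IidSample.
Context (R : realType) (dO d : measure_display).
Context (Omega : measurableType dO) (P : probability Omega R).
Context (S : measurableType d) (pi : probability S R).
Context (n : nat) (Z : 'I_n -> {RV P >-> S}) (V : finType) (p : S -> V).
Context (hp : measurable_fibers p) (hZ : iid_sample pi Z).

Definition sample_pattern (w : Omega) : {ffun 'I_n -> V} :=
  [ffun i => p (Z i w)].

Let fiberE v : sample_pattern @^-1` [set v]
  = \bigcap_(i in [set i | i \in [set: 'I_n]%SET]) (Z i @^-1` (p @^-1` [set v i])).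
Proof.
apply/seteqP; split => [w <- i _ /=|w h /=]; first by rewrite ffunE.
by apply/ffunP => i; rewrite ffunE; apply: h; rewrite /= finset.in_setT.
Qed.

Lemma sample_measurable : measurable_fibers sample_pattern.
Proof.
move=> v; rewrite fiberE; apply: fin_bigcap_measurable => // i _.
by rewrite -[X in measurable X]setTI; exact: (measurable_funPT (Z i)).
Qed.

Lemma sample_law : law P sample_pattern = iid_pmf (law pi p).
Proof.
have [hlaw hind] := hZ.
apply/funext => v; apply: EFin_inj; rewrite lawE ?fiberE; last exact: sample_measurable.
rewrite hind => [|i]; last exact: hp.
rewrite /iid_pmf -prodEFin; apply: eq_big => [i|i _].
  by rewrite finset.in_setT.
by rewrite lawE// -(hlaw i).
Qed.

End IidSample.

(** * Reduction of classification to finitely many cells *)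

Definition pm1 (R : realType) (b : bool) : R := if b then 1 else -1.

(** [None] stands for the values that are not labels; they form a null set. *)
Definition read_label (R : realType) (y : R) : option bool :=
  if y == 1 then Some true else if y == -1 then Some false else None.

Definition label_value (R : realType) (l : option bool) : R :=
  if l is Some b then pm1 R b else 0.

Section Labels.
Context (R : realType).
Implicit Types (y : R) (b : bool).

Lemma neg1_neq1 : (-1 == 1 :> R) = false.
Proof. by apply/negbTE/eqP => h; lra. Qed.

Lemma read_label_pm1 b : read_label (pm1 R b) = Some b.
Proof. by case: b; rewrite /read_label /pm1 ?neg1_neq1 eqxx. Qed.

Lemma read_labelK y b : (read_label y == Some b) = (y == pm1 R b).
Proof.
apply/eqP/eqP => [|->]; last exact: read_label_pm1.
by rewrite /read_label /pm1; do 2!(case: eqP => [->|_]; first by case: b).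
Qed.

Lemma sign_pm1 (t : R) : sign t = pm1 R (0 <= t).
Proof. by []. Qed.

Lemma pm1_ge0 b : (0 <= pm1 R b) = b.
Proof. by case: b; rewrite /pm1 ?ler01// leNgt ?oppr_lt0 ?ltr01. Qed.

Lemma measurable_read_label (l : option bool) :
  measurable ([set y : R | read_label y = l]).
Proof.
have mb b : measurable [set y : R | read_label y = Some b].
  rewrite (_ : [set y | _] = [set pm1 R b]) //.
  apply/seteqP; split => y /= /eqP; first by rewrite read_labelK => /eqP.
  by move=> /eqP ->; exact: read_label_pm1.
case: l => [b|]; first exact: mb.
rewrite (_ : [set y | _] = ~` ([set y | read_label y = Some true]
   `|` [set y : R | read_label y = Some false])).
  by apply: measurableC; apply: measurableU; exact: mb.
apply/seteqP; split => y /=; first by move=> -> [].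
by case: (read_label y) => // -[] h; exfalso; apply: h; [left|right].
Qed.

End Labels.

Lemma mean_by_label (R : realType) (U : finType) (q phi : U * option bool -> R) :
  mean q phi = \sum_u (q (u, None) * phi (u, None)
    + (q (u, Some true) * phi (u, Some true)
       + q (u, Some false) * phi (u, Some false))).
Proof.
rewrite /mean (eq_bigr (fun v => q (v.1, v.2) * phi (v.1, v.2))); last by case.
rewrite -(pair_bigA _ (fun u l => q (u, l) * phi (u, l)))/=.
apply: eq_bigr => u _.
rewrite (bigD1 None)//= (bigD1 (Some true))//= (bigD1 (Some false))//=.
by rewrite big_pred0 ?addr0 => [|[[]|]].
Qed.

(** Classification with design points reduced to a cell [pat x] of a finite
    partition, on each of which the Bayes rule is constant. *)
Section Classification.
Context (R : realType) (d : measure_display) (T : measurableType d).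
Context (pi : probability (T * R)%type R) (eta : T -> R).
Context (hlab : binary_labels pi) (heta : regression_function pi eta).
Context (U : finType) (pat : T -> U) (star : U -> bool).
Context (hpat : measurable_fibers pat).
Context (hstar : forall x, bayes_rule eta x = pm1 R (star (pat x))).

Definition observe (z : T * R) : U * option bool := (pat z.1, read_label z.2).

Let q := law pi observe.

Let fiberE u l : observe @^-1` [set (u, l)]
  = (pat @^-1` [set u]) `*` [set y | read_label y = l].
Proof. by apply/seteqP; split => [z [<- <-]|z [/= <- <-]]. Qed.

Lemma observe_measurable : measurable_fibers observe.
Proof.
move=> [u l]; rewrite fiberE; apply: measurableX; first exact: hpat.
exact: measurable_read_label.
Qed.

Lemma law_unlabelled u : q (u, None) = 0.
Proof.
pose B : set (T * R) := setT `*` [set y | y = -1 \/ y = 1].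
have mB : measurable B.
  apply: measurableX => //.
  rewrite (_ : [set y | _] = [set -1] `|` [set 1]) //.
  exact: measurableU.
have : pi (~` B) = 0%E.
  by rewrite probability_setC// hlab subee.
move=> hB; apply: EFin_inj; rewrite lawE; last exact: observe_measurable.
apply/eqP; rewrite eq_le; apply/andP; split; last exact: measure_ge0.
rewrite -[leRHS]/(0%E) -hB.
apply: le_measure; rewrite ?inE; [exact: observe_measurable|exact: measurableC|].
move=> z /= [_ hz] [_ /= hz2].
case: hz2 => hz2; rewrite hz2 in hz.
  by have := read_label_pm1 R false; rewrite hz.
by have := read_label_pm1 R true; rewrite hz.
Qed.

Lemma law_labelled u b :
  (q (u, Some b))%:E = pi ((pat @^-1` [set u]) `*` [set pm1 R b]).
Proof.
rewrite lawE; last exact: observe_measurable.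
rewrite fiberE; congr (pi (_ `*` _)); apply/seteqP.
split => y /=; first by move/eqP; rewrite read_labelK => /eqP.
by move=> ->; exact: read_label_pm1.
Qed.

(** On a cell where the Bayes rule is 1, [eta >= 1 / 2], so integrating [eta]
    over the cell shows that label 1 has at least half of its mass; likewise
    for label -1 where the Bayes rule is -1. *)
Lemma law_bayes_sign u :
  0 <= pm1 R (star u) * (q (u, Some true) - q (u, Some false)).
Proof.
set A := pat @^-1` [set u].
have mA : measurable A by exact: hpat.
have mAT : measurable (A `*` [set: R]) by exact: measurableX.
have tot : pi (A `*` [set: R]) = (q (u, Some true) + q (u, Some false))%:E.
  have := law_pred pi observe_measurable (fun v => v.1 == u).
  have -> : [set z | (observe z).1 == u] = A `*` [set: R].
    by apply/seteqP; split => [z /= /eqP|z [/= -> _]].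
  move=> h; rewrite -[LHS]fineK ?fin_num_measure// h; congr EFin.
  rewrite mean_by_label (bigD1 u)//= eqxx [X in _ + X]big1 => [|u' /negbTE->].
    by rewrite !mulr1 -/q law_unlabelled add0r addr0.
  by rewrite !mulr0 !addr0.
have [meta int] := heta.
have qT : (q (u, Some true))%:E = (\int[pi]_(z in A `*` [set: R]) (eta z.1)%:E)%E.
  by rewrite int// law_labelled.
have mh : measurable_fun (A `*` [set: R]) (EFin \o (eta \o fst)).
  apply/measurable_EFinP; apply: measurable_funTS.
  by apply: measurableT_comp.
have inth : (\int[pi]_(z in A `*` [set: R]) (1 / 2)%:E
   = (1 / 2 * (q (u, Some true) + q (u, Some false)))%:E)%E.
  by rewrite integral_cst// [X in (_ * X)%E]tot.
have hA z : (A `*` [set: R]) z -> (0 <= 2 * eta z.1 - 1) = star u.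
  move=> [/= <- _]; have := hstar z.1; rewrite /bayes_rule sign_pm1 => h.
  by rewrite -[LHS](pm1_ge0 R) h pm1_ge0.
case hs : (star u) hA => hA; rewrite /pm1.
  suff : ((1 / 2 * (q (u, Some true) + q (u, Some false)))%:E
      <= (q (u, Some true))%:E)%E by rewrite lee_fin; lra.
  rewrite -inth qT.
  apply: ge0_le_integral => // z /hA h; rewrite lee_fin; lra.
suff : ((q (u, Some true))%:E
    <= (1 / 2 * (q (u, Some true) + q (u, Some false)))%:E)%E.
  by rewrite lee_fin; lra.
(* eta may fail to be nonnegative here, so its positive part is compared *)
rewrite -inth qT integralE.
apply: (@le_trans _ _ (\int[pi]_(z in A `*` [set: R]) ((fun z => (eta z.1)%:E)^\+ z))%E).
  by apply: geeDl; rewrite oppe_le0; exact: integral_ge0.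
apply: ge0_le_integral => //; first exact: measurable_funepos.
move=> z /hA h; rewrite funeposE -EFin_max lee_fin ge_max.
have : ~~ (0 <= 2 * eta z.1 - 1) by rewrite h.
by rewrite -ltNge => h2; apply/andP; split; lra.
Qed.

(** A difference of 0-1 losses at a label [y] is half the difference of the
    gains; for an invalid label both losses are 1 and [label_value] is 0. *)
Lemma excess_riskE (gamma : U -> R) :
  excess_risk pi eta (gamma \o pat)
  = mean q (fun v => 1 / 2 * (label_value R v.2
       * (pm1 R (star v.1) - pm1 R (0 <= gamma v.1)))).
Proof.
have riskE (h : U -> R) : risk pi (h \o pat)
    = mean q (fun v => (v.2 != Some (0 <= h v.1))%:R).
  rewrite -(law_pred pi observe_measurable (fun v => v.2 != Some (0 <= h v.1))).
  rewrite /risk; congr (fine (pi _)); apply/seteqP.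
  by split => z; rewrite /= read_labelK.
rewrite /excess_risk (_ : bayes_rule eta = (fun u => pm1 R (star u)) \o pat);
  last by apply/funext => x; exact: hstar.
rewrite !riskE /mean -sumrB; apply: eq_bigr => -[u l] _ /=.
rewrite -mulrBr pm1_ge0; congr (_ * _).
case: l => [b|] /=; last by rewrite subrr mul0r mulr0.
by rewrite !(inj_eq Some_inj) /pm1; case: b; case: (star u); case: (0 <= _) => /=; lra.
Qed.

(** Optimality of the Bayes rule in linear form: a function with the sign of the Bayes rule is nonnegatively correlated with
    the label. *)
Lemma mean_label_ge0 (h : U -> R) :
  (forall u, 0 <= pm1 R (star u) * h u) ->
  0 <= mean q (fun v => label_value R v.2 * h v.1).
Proof.
move=> hh; rewrite mean_by_label; apply: sumr_ge0 => u _ /=.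
have := mulr_ge0 (law_bayes_sign u) (hh u).
by rewrite /pm1; case: (star u); lra.
Qed.

Lemma excess_risk_ge0 (gamma : U -> R) : 0 <= excess_risk pi eta (gamma \o pat).
Proof.
rewrite excess_riskE meanZ mulr_ge0//.
apply: (@mean_label_ge0 (fun u => pm1 R (star u) - pm1 R (0 <= gamma u))) => u.
by rewrite /pm1; case: (star u); case: ifP => _; lra.
Qed.

Lemma excess_risk_le1 (gamma : U -> R) : excess_risk pi eta (gamma \o pat) <= 1.
Proof.
have hq : is_pmf q := law_pmf pi observe_measurable.
rewrite excess_riskE -[leRHS](mean_cst hq); apply: (mean_le hq) => -[u [b|]] /=.
  by rewrite /pm1; case: b; case: (star u); case: ifP => _; lra.
by lra.
Qed.

(** Zhang's inequality. The difference of the two deficits has the sign of the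
    Bayes rule: where [gamma] agrees in sign with it this is [`|gamma| <= 1],
    and elsewhere the difference is [- gamma]. *)
Lemma excess_risk_le_hinge (gamma : U -> R) : (forall u, `|gamma u| <= 1) ->
  excess_risk pi eta (gamma \o pat)
    <= mean q (fun v => label_value R v.2 * (pm1 R (star v.1) - gamma v.1)).
Proof.
move=> hg; rewrite excess_riskE -subr_ge0 /mean -sumrB.
pose h u := (pm1 R (star u) - gamma u) - 1 / 2 * (pm1 R (star u) - pm1 R (0 <= gamma u)).
have := @mean_label_ge0 h; rewrite /mean => H; apply: le_trans (H _) _.
  move=> u; have := hg u; rewrite ler_norml /h /pm1 => /andP[h1 h2].
  by case: (star u); case: ifP => /= h3; try (move: h3 => /negbT; rewrite -ltNge => h3); lra.
by apply: ler_sum => v _; rewrite /h; lra.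
Qed.

Lemma excess_risk_rule (b : U -> bool) :
  mean q (fun v => label_value R v.2 * (pm1 R (star v.1) - pm1 R (b v.1)))
  = 2 * excess_risk pi eta ((fun u => pm1 R (b u)) \o pat).
Proof.
by rewrite excess_riskE -meanZ; apply: eq_mean => v /=; rewrite pm1_ge0; lra.
Qed.

End Classification.

(** * The aggregate with exponential weights *)

Lemma aew_weightE (R : realType) (T : Type) (n M : nat)
    (f : 'I_M -> T -> R) (D : 'I_n -> T * R) :
  aew_weight f D = gibbs (fun j => \sum_i (D i).2 * f j (D i).1).
Proof. by []. Qed.

Section DesignPattern.
Context (R : realType) (d : measure_display) (T : measurableType d).
Context (K : finType) (h : K -> T -> R).
Context (hrule : forall k, prediction_rule (h k)).

(** The cell of a design point: the joint predictions of all rules. *)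
Definition votes (x : T) : {ffun K -> bool} := [ffun k => h k x == 1].

Lemma votesE k x : h k x = pm1 R (votes x k).
Proof.
by rewrite ffunE; case: ((hrule k).2 x) => ->; rewrite ?eqxx ?neg1_neq1.
Qed.

Lemma votes_measurable : measurable_fibers votes.
Proof.
move=> v; rewrite (_ : _ @^-1` _ = \bigcap_k (h k @^-1` [set pm1 R (v k)])).
  apply: fin_bigcap_measurable => // k _; rewrite -[X in measurable X]setTI.
  exact: (hrule k).1.
apply/seteqP; split => [x <- k _ /=|x hx]; first exact: votesE.
apply/ffunP => k; have := hx k I; rewrite /= votesE.
by case: (votes x k); case: (v k) => //; rewrite /pm1 => h1; exfalso; lra.
Qed.

End DesignPattern.

Lemma bayes_prediction_rule (R : realType) (d : measure_display)
    (T : measurableType d) (eta : T -> R) :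
  measurable_fun [set: T] eta -> prediction_rule (bayes_rule eta).
Proof.
move=> meta; split; last first.
  by move=> x; rewrite /bayes_rule /sign; case: ifP; [right|left].
rewrite /bayes_rule /sign; apply: measurable_fun_ifT => //.
apply: measurable_fun_ler => //; apply: measurable_funB => //.
exact: measurable_funM.
Qed.

Theorem corollary1 (R : realType) (a c0 : R) (ha : 0 < a) (hc0 : 0 < c0) :
  exists C : R, 0 < C /\
  forall (d dO : measure_display) (T : measurableType d)
    (Omega : measurableType dO) (P : probability Omega R)
    (pi : probability (T * R)%type R) (eta : T -> R)
    (kappa : R) (n M : nat)
    (Z : 'I_n -> {RV P >-> (T * R)%type}) (f : 'I_M -> T -> R),
    1 <= kappa -> (0 < n)%N -> (3 <= M)%N ->
    binary_labels pi ->
    regression_function pi eta ->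
    margin_assumption pi eta kappa c0 ->
    (forall j, prediction_rule (f j)) ->
    iid_sample pi Z ->
    ('E_P[fun w => excess_risk pi eta (aew f (fun i => Z i w))]
      <= (2 * (1 + a))%:E
           * \big[mine/+oo]_(j < M) (excess_risk pi eta (f j))%:E
         + (C * (ln M%:R / n%:R) `^ (kappa / (2 * kappa - 1)))%:E)%E.
Proof.
pose C := 1 + 2 * a + 4 * (1 + a) ^+ 2 * (1 + 2 * c0) / a.
have C1 : 1 <= C.
  rewrite /C -addrA lerDl addr_ge0// ?divr_ge0 ?mulr_ge0 ?sqr_ge0 ?(ltW ha)//; lra.
exists C; split; first by lra.
move=> d dO T Omega P pi eta kappa n M Z f hk n0 M3 hlab heta hmargin hf hZ.
have M0 : (0 < M)%N by exact: leq_trans M3.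
(* the Bayes rule is added to the given rules, with index None *)
pose h (k : option 'I_M) : T -> R := if k is Some j then f j else bayes_rule eta.
have hrule k : prediction_rule (h k).
  by case: k => [j|] /=; [exact: hf|exact: bayes_prediction_rule heta.1].
pose U : finType := {ffun option 'I_M -> bool}.
pose pat : T -> U := votes h.
have hpat : measurable_fibers pat := votes_measurable hrule.
pose star (u : U) := u None.
pose rule j (u : U) := u (Some j).
have hstar x : bayes_rule eta x = pm1 R (star (pat x)) := votesE hrule None x.
have hruleE j x : f j x = pm1 R (rule j (pat x)) := votesE hrule (Some j) x.
pose obs := observe pat : T * R -> U * option bool.
have hobs : measurable_fibers obs := observe_measurable hpat.
pose q := law pi obs.
have hq : is_pmf q := law_pmf pi hobs.
pose g0 (v : U * option bool) : R := label_value R v.2 * pm1 R (star v.1).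
pose g j (v : U * option bool) : R := label_value R v.2 * pm1 R (rule j v.1).
pose m j := mean q (fun v => g0 v - g j v).
pose e j := excess_risk pi eta (f j).
have fE j : f j = (fun u => pm1 R (rule j u)) \o pat.
  by apply/funext => x; exact: hruleE.
have me j : m j = 2 * e j.
  rewrite /e fE -(excess_risk_rule pi hpat hstar); apply: eq_mean => v.
  by rewrite /g0 /g mulrBr.
have e0 j : 0 <= e j by rewrite /e fE; exact: excess_risk_ge0.
pose gamma w (u : U) :=
  \sum_j aew_weight f (fun i => Z i w) j * pm1 R (rule j u).
have aewE w : aew f (fun i => Z i w) = gamma w \o pat.
  by apply/funext => x; rewrite /aew /=; apply: eq_bigr => j _; rewrite hruleE.
pose F w := excess_risk pi eta (aew f (fun i => Z i w)).
have F0 w : 0 <= F w.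
  by rewrite /F aewE; exact: excess_risk_ge0.
have F1 w : F w <= 1.
  by rewrite /F aewE; exact: excess_risk_le1.
have [j0 minE] : exists j0, (\big[mine/+oo]_(j < M) (e j)%:E = (e j0)%:E)%E.
  have [j0 _ ->] := eq_bigmin (Ordinal M0) xpredT (fun j => (e j)%:E) isT (fun _ _ => leey _).
  by exists j0.
rewrite minE -EFinM -EFinD.
set s := ln M%:R / n%:R; set r := s `^ _.
have s0 : 0 < s by rewrite divr_gt0 ?ltr0n// ln_gt0// ltr1n; exact: leq_trans M3.
(* if ln M > n the remainder alone exceeds 1, hence the excess risk *)
have [s1|s1] := leP s 1; last first.
  apply: le_trans (expectation_mono P F0 F1) _.
  rewrite [leLHS](expectation_cst P 1) lee_fin.
  have r1 : 1 <= r.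
    rewrite -(powRr0 s) ler_powR ?(ltW s1)// divr_ge0//; lra.
  have : 1 <= C * r by nra.
  have : 0 <= 2 * (1 + a) * e j0 by rewrite !mulr_ge0//; lra.
  lra.
pose wt (v : {ffun 'I_n -> U * option bool}) := gibbs (fun j => \sum_i g j (v i)).
(* the count of invalid labels, of mean 0, dominates the excess risk on the
   samples for which the pattern does not determine the weights *)
pose G (v : {ffun 'I_n -> U * option bool}) :=
  \sum_k wt v k * m k + \sum_i ((v i).2 == None)%:R.
have FG w : F w <= G (sample_pattern Z obs w).
  have wt0 : 0 <= \sum_k wt (sample_pattern Z obs w) k * m k.
    by apply: sumr_ge0 => k _; rewrite mulr_ge0 ?(ltW (gibbs_gt0 _ _))// me mulr_ge0.
  have cnt0 i : 0 <= ((sample_pattern Z obs w i).2 == None)%:R :> R by [].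
  have [/forallP/= good|/forallPn/= [i bad]] :=
    boolP [forall i, (sample_pattern Z obs w i).2 != None]; last first.
    rewrite negbK in bad.
    apply: le_trans (F1 w) _; rewrite /G (bigD1 i)//= bad.
    rewrite -[leLHS]add0r lerD// lerDl; exact: sumr_ge0.
  rewrite /G [X in _ + X]big1 ?addr0 => [|i _]; last by rewrite (negbTE (good i)).
  rewrite /F aewE.
  have wtE : aew_weight f (fun i => Z i w) = wt (sample_pattern Z obs w).
    rewrite aew_weightE /wt; congr gibbs; apply/funext => j; apply: eq_bigr => i _.
    rewrite hruleE /g; congr (_ * _); last by rewrite ffunE.
    have := good i; rewrite ffunE /=; case E : (read_label _) => [b|]// _.
    by apply/eqP; rewrite -read_labelK E.
  have wt1 : \sum_k wt (sample_pattern Z obs w) k = 1 := gibbs_sum1 _ j0.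
  apply: le_trans (excess_risk_le_hinge hlab heta hpat hstar _) _.
    move=> u; rewrite /gamma wtE (le_trans (ler_norm_sum _ _ _))// -wt1.
    apply: ler_sum => k _; rewrite normrM ger0_norm ?(ltW (gibbs_gt0 _ _))//.
    by rewrite ger_pMr ?gibbs_gt0// /pm1; case: ifP => _; rewrite ?normrN normr1.
  rewrite -/obs -/q (_ : mean q _ = mean q (fun v =>
      \sum_k wt (sample_pattern Z obs w) k * (g0 v - g k v))).
    by rewrite mean_sum; apply: ler_sum => k _; rewrite meanZ.
  apply: eq_mean => v; rewrite /gamma wtE mulrBr -/(g0 v).
  under [in RHS]eq_bigr do rewrite mulrBr.
  rewrite sumrB -mulr_suml wt1 mul1r mulr_sumr; congr (_ - _).
  by apply: eq_bigr => k _; rewrite /g mulrCA.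
apply: le_trans (expectation_mono P F0 FG) _.
rewrite (expectation_law _ (sample_measurable Z hobs)) (sample_law hobs hZ) -/q.
rewrite lee_fin /G meanD (mean_iid_sum n (fun v => (v.2 == None)%:R) hq).
have -> : mean q (fun v => (v.2 == None)%:R) = 0.
  apply: big1 => -[u [b|]] _ /=; first by rewrite mulr0.
  by rewrite /q (law_unlabelled hlab) ?mul0r.
rewrite mulr0 addr0 (_ : 2 * (1 + a) * e j0 = (1 + a) * m j0); last by rewrite me; ring.
have b0 : 0 <= 2 * c0 by lra.
apply: (gibbs_oracle_inequality ha b0 hk hq n0) => //.
- move=> j [u l]; rewrite /g0 /g /=.
  by case: l => [[]|]; rewrite /pm1; case: (star u);
    case: (rule j u) => /=; rewrite ler_norml; lra.
- by move=> j; rewrite -/(m j) me mulr_ge0.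
move=> j; rewrite -/(m j).
have := hmargin _ (hf j).
rewrite (_ : (fun z => _) = (fun z => `|pm1 R (rule j (obs z).1) - pm1 R (star (obs z).1)|));
  last by apply/funext => z; rewrite hruleE hstar.
rewrite (expectation_law _ hobs
  (fun v => `|pm1 R (rule j v.1) - pm1 R (star v.1)|)).
rewrite lee_fin -/q -/(e j) => H.
apply: (@le_trans _ _ (2 * mean q (fun v => `|pm1 R (rule j v.1) - pm1 R (star v.1)|))).
  rewrite -meanZ; apply: (mean_le hq) => -[u l]; rewrite /g0 /g /=.
  have := ler_norm (pm1 R (rule j u) - pm1 R (star u)).
  have := ler_norm (- (pm1 R (rule j u) - pm1 R (star u))); rewrite normrN.
  by case: l => [[]|]; rewrite /pm1 /=; case: (star u); case: (rule j u); lra.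
have p1 : e j `^ (1 / kappa) <= m j `^ (1 / kappa).
  have := e0 j => ej; rewrite me; apply: ge0_ler_powR; rewrite ?nnegrE; [|lra..].
  by rewrite divr_ge0//; lra.
have : c0 * e j `^ (1 / kappa) <= c0 * m j `^ (1 / kappa) by rewrite ler_pM2l.
lra.
Qed.
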